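(* Let $M=(\mathcal O,\mathcal A,p,\mathcal R,H)$ and $\widehat M=(\mathcal O,\mathcal A,\widehat p,\mathcal R,H)$ be two NMRDPs that differ only in their transition kernels. Then for any (possibly history-dependent) policy $\pi$, $$\left|\widehat J(\pi)-J(\pi)\right|\le\sum_{m=1}^{H}\;\sum_{o_m\in\mathcal O,\,a_m\in\mathcal A,\,o_{m+1}\in\mathcal O}\epsilon(o_{m+1}|o_m,a_m)\,\mu_m^\pi(o_m,a_m)\,G,$$ where $\epsilon(o_{m+1}|o_m,a_m)=\left|\widehat p(o_{m+1}|o_m,a_m)-p(o_{m+1}|o_m,a_m)\right|$.
   Context: A Non-Markovian Reward Decision Process (NMRDP) $M=(\mathcal O,\mathcal A,p,\mathcal R,H)$ consists of finite sets $\mathcal O$ (observations) and $\mathcal A$ (actions), a transition kernel $p(o'|o,a)$ together with an initial distribution $p(o_1)$ (the same in $M$ and $\widehat M$), a horizon $H\ge1$, and a reward $\mathcal R$ that may depend on the whole history of observations and actions; per-step rewards lie in $[0,1]$. For a trajectory $\eta=(o_t,a_t)_{t=1}^H$, $F(\eta)$ denotes the expected total reward collected along $\eta$ (determined by $\mathcal R$, the same in $M$ and $\widehat M$), and $G=\max_\eta F(\eta)$. A policy $\pi$ specifies probabilities $\pi(a_t|o_1,a_1,\dots,o_{t-1},a_{t-1},o_t)$. $J(\pi)$ and $\widehat J(\pi)$ are the expected values of $F(\eta)$ when $\eta$ is generated by $\pi$ in $M$ and $\widehat M$, respectively. $\mu_m^\pi(o,a)$ is the probability that $(o_m,a_m)=(o,a)$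 when $\pi$ is executed in $M$. *)

(* Defs.v *)
(* MathComp / MathComp-Analysis *)
From HB Require Import structures.
From mathcomp Require Import all_boot all_order all_algebra.
From mathcomp Require Import all_classical all_reals all_analysis.

Set Implicit Arguments.
Unset Strict Implicit.
Unset Printing Implicit Defensive.

Import Order.TTheory GRing.Theory Num.Theory.
Local Open Scope ring_scope.

Record fdist (R : realType) (T : finType) := FDist {
  fdist_val :> T -> R;
  fdist_ge0 : forall x, 0 <= fdist_val x;
  fdist_sum1 : \sum_x fdist_val x = 1 }.

(* A history is the sequence [:: (o_1, a_1); ...; (o_t, a_t)], oldest first.
   nm_reward h is the law of the (possibly random) reward received at step
   t = size h; deterministic rewards are Dirac measures.  Only histories with
   1 <= t <= H are ever used. *)
Record nmrdp (R : realType) (O A : finType) (H : nat) := Nmrdp {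
  nm_init : fdist R O;
  nm_trans : O -> A -> fdist R O;
  nm_reward : seq (O * A) -> probability (measurableTypeR R) R;
  nm_reward01 : forall h : seq (O * A), (0 < size h <= H)%N ->
    nm_reward h [set r : measurableTypeR R | 0 <= r <= 1]%classic = 1%E }.

(* pol h o is the law of the next action, given the past (observation, action)
   pairs h and the current observation o. *)
Definition policy (R : realType) (O A : finType) : Type :=
  seq (O * A) -> O -> fdist R A.

(* Trajectories eta : H.-tuple (O * A) are indexed from 0: the pair (o_m, a_m)
   is tnth eta i with i = m - 1, and its strict past is take i eta. *)

Definition next_obs (R : realType) (O A : finType) (H : nat)
    (M : nmrdp R O A H) (h : seq (O * A)) : fdist R O :=
  if h is x :: s then nm_trans M (last x s).1 (last x s).2 else nm_init M.

Definition traj_prob (R : realType) (O A : finType) (H : nat)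
    (M : nmrdp R O A H) (pol : policy R O A) (eta : H.-tuple (O * A)) : R :=
  \prod_(i < H) (next_obs M (take i eta) (tnth eta i).1 *
                 pol (take i eta) (tnth eta i).1 (tnth eta i).2).

Definition mean_reward (R : realType) (O A : finType) (H : nat)
    (M : nmrdp R O A H) (h : seq (O * A)) : R :=
  fine ('E_(nm_reward M h)[(fun r : measurableTypeR R => r : R)])%E.

Definition traj_return (R : realType) (O A : finType) (H : nat)
    (M : nmrdp R O A H) (eta : H.-tuple (O * A)) : R :=
  \sum_(i < H) mean_reward M (take i.+1 eta).

(* The base value 0 does not affect the maximum: returns are nonnegative. *)
Definition max_return (R : realType) (O A : finType) (H : nat)
    (M : nmrdp R O A H) : R :=
  \big[Num.max/0]_(eta : H.-tuple (O * A)) traj_return M eta.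

Definition exp_return (R : realType) (O A : finType) (H : nat)
    (M : nmrdp R O A H) (pol : policy R O A) : R :=
  \sum_(eta : H.-tuple (O * A)) traj_prob M pol eta * traj_return M eta.

Definition occupancy (R : realType) (O A : finType) (H : nat)
    (M : nmrdp R O A H) (pol : policy R O A) (m : 'I_H) (o : O) (a : A) : R :=
  \sum_(eta : H.-tuple (O * A) | tnth eta m == (o, a)) traj_prob M pol eta.

(* Main.v *)
(* Since 0 <= F <= G, the gap between the two values is at most G times the l1
   distance between the trajectory laws.  That distance is bounded by a hybrid
   argument: swapping the kernel at one step costs the l1 distance between the
   two next-step laws, averaged over the past generated by M; the action law is
   common to both, so only the transition discrepancy at (o_m, a_m) remains. *)
Require Import Defs.
From mathcomp Require Import all_boot all_order all_algebra.
From mathcomp Require Import all_classical all_reals all_analysis.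
From mathcomp Require Import measurable_realfun.

Import Order.TTheory GRing.Theory Num.Theory.
Local Open Scope ring_scope.

Set Implicit Arguments.
Unset Strict Implicit.

Lemma sum_tuple_cons (V : nmodType) (T : finType) (n : nat)
    (F : n.+1.-tuple T -> V) :
  \sum_(t : n.+1.-tuple T) F t =
  \sum_(x : T) \sum_(t : n.-tuple T) F [tuple of x :: t].
Proof.
rewrite pair_bigA /=.
rewrite (reindex (fun p : T * n.-tuple T => [tuple of p.1 :: p.2])) //.
exists (fun t : n.+1.-tuple T => (thead t, [tuple of behead t])).
- by move=> [x t] _ /=; congr pair; apply/val_inj.
- by move=> t _; rewrite /= -tuple_eta.
Qed.

Section TrajectoryWeight.
Variables (R : realType) (T : finType).

(** The past [h] is a parameter so that an induction on [n] can move the first entry of the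
    trajectory into it. *)
Definition traj_weight (k : seq T -> T -> R) (h : seq T) (n : nat)
    (t : n.-tuple T) : R :=
  \prod_(i < n) k (h ++ take i t) (tnth t i).

Lemma traj_weight_cons k h n x (t : n.-tuple T) :
  traj_weight k h [tuple of x :: t] = k h x * traj_weight k (rcons h x) t.
Proof.
rewrite /traj_weight big_ord_recl tnth0 /= cats0; congr (_ * _).
by apply: eq_bigr => i _; rewrite tnthS /= cat_rcons.
Qed.

Lemma traj_weight_ge0 k h n (t : n.-tuple T) : (forall s x, 0 <= k s x) ->
  0 <= traj_weight k h t.
Proof. by move=> k0; apply: prodr_ge0. Qed.

Lemma sum_traj_weight k h n : (forall s, \sum_x k s x = 1) ->
  \sum_(t : n.-tuple T) traj_weight k h t = 1.
Proof.
move=> k1; elim: n h => [|n IHn] h.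
  rewrite (eq_bigr (fun=> 1)) => [|t _]; last by rewrite /traj_weight big_ord0.
  by rewrite sumr_const card_tuple expn0.
rewrite sum_tuple_cons -[RHS](k1 h); apply: eq_bigr => x _.
under eq_bigr do rewrite traj_weight_cons.
by rewrite -mulr_sumr IHn mulr1.
Qed.

(** Induction from the front: the first step is swapped while the tail still follows [k'], whose
    total weight is 1. The tails are then compared from the past [rcons h x], weighted by [k h x],
    so every past is averaged under [k]. *)
Lemma sum_dist_traj_weight (k k' : seq T -> T -> R) h n :
  (forall s x, 0 <= k s x) -> (forall s x, 0 <= k' s x) ->
  (forall s, \sum_x k s x = 1) -> (forall s, \sum_x k' s x = 1) ->
  \sum_(t : n.-tuple T) `|traj_weight k' h t - traj_weight k h t| <=
  \sum_(m < n) \sum_(t : n.-tuple T) traj_weight k h t *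
    \sum_x `|k' (h ++ take m t) x - k (h ++ take m t) x|.
Proof.
move=> k_ge0 k'_ge0 k_sum k'_sum; elim: n h => [|n IHn] h.
  rewrite big_ord0 big1 // => t _.
  by rewrite /traj_weight !big_ord0 subrr normr0.
rewrite big_ord_recl /=.
(* For [m = 0] the history is [h] whatever [t] is, so the weights sum to 1. *)
under [X in _ <= X + _]eq_bigr do rewrite take0 cats0.
rewrite -mulr_suml sum_traj_weight // mul1r sum_tuple_cons.
under [X in _ <= _ + X]eq_bigr do rewrite sum_tuple_cons.
rewrite [X in _ <= _ + X]exchange_big /= -big_split /=; apply: ler_sum => x _.
(* The split is [k' W' - k W = (k' - k) W' + k (W' - W)], with [W'] and [W] the tail weights. *)
apply: (@le_trans _ _ (\sum_(t : n.-tuple T)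
  (`|k' h x - k h x| * traj_weight k' (rcons h x) t +
   k h x * `|traj_weight k' (rcons h x) t - traj_weight k (rcons h x) t|))).
  apply: ler_sum => t _; rewrite !traj_weight_cons.
  rewrite -[X in _ * X + _]ger0_norm ?traj_weight_ge0 //.
  rewrite -[X in _ + X * _]ger0_norm // -!normrM.
  apply: le_trans (ler_normD _ _); rewrite mulrBl mulrBr.
  by rewrite addrA subrK.
rewrite big_split /= -!mulr_sumr sum_traj_weight // mulr1 lerD2l.
apply: le_trans (ler_wpM2l (k_ge0 h x) (IHn _)) _.
rewrite mulr_sumr; apply: ler_sum => m _; rewrite mulr_sumr.
apply: ler_sum => t _; rewrite traj_weight_cons mulrA /=.
by under eq_bigr do rewrite cat_rcons.
Qed.

End TrajectoryWeight.

Lemma mean_reward_ge0 (R : realType) (O A : finType) (H : nat)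
    (M : nmrdp R O A H) (h : seq (O * A)) :
  (0 < size h <= H)%N -> 0 <= mean_reward M h.
Proof.
move=> /(nm_reward01 M) reward01; rewrite /mean_reward; apply: fine_ge0.
have mD : measurable [set r : measurableTypeR R | 0 <= r <= 1]%classic.
  rewrite (_ : [set _ | _]%classic = [set` `[0, 1]%R]%classic).
    exact: measurable_itv.
  by apply/seteqP; split => r /=; rewrite in_itv.
(* The reward lies in [0, 1] only almost surely, so the integrand [r] is replaced by its absolute
   value, which differs from it only on a null set. *)
rewrite unlock (ae_eq_integral (fun r : measurableTypeR R => `|r|%:E)%E) //.
- by apply: integral_ge0 => r _; rewrite lee_fin.
- by apply/measurable_EFinP; exact: normr_measurable.
- exists (~` [set r : measurableTypeR R | 0 <= r <= 1])%classic; split.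
  + exact: measurableC.
  + apply: etrans (probability_setC (nm_reward M h) mD) _.
    by rewrite reward01 subee.
  + move=> r /=; apply: contra_not => /andP[r0 _] _.
    by rewrite ger0_norm.
Qed.

Lemma traj_return_ge0 (R : realType) (O A : finType) (H : nat)
    (M : nmrdp R O A H) (eta : H.-tuple (O * A)) : 0 <= traj_return M eta.
Proof.
apply: sumr_ge0 => i _; apply: mean_reward_ge0.
by rewrite size_takel ?size_tuple /=.
Qed.

Lemma traj_return_le_max (R : realType) (O A : finType) (H : nat)
    (M : nmrdp R O A H) (eta : H.-tuple (O * A)) :
  traj_return M eta <= max_return M.
Proof. exact: le_bigmax. Qed.

Lemma max_return_ge0 (R : realType) (O A : finType) (H : nat)
    (M : nmrdp R O A H) : 0 <= max_return M.
Proof. exact: bigmax_ge_id. Qed.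

Section Kernel.
Variables (R : realType) (O A : finType) (H : nat).
Implicit Types (M : nmrdp R O A H) (pol : policy R O A).

Definition step_kernel M pol (h : seq (O * A)) (x : O * A) : R :=
  next_obs M h x.1 * pol h x.1 x.2.

Lemma traj_probE M pol eta :
  traj_prob M pol eta = traj_weight (step_kernel M pol) [::] eta.
Proof. by []. Qed.

Lemma step_kernel_ge0 M pol h x : 0 <= step_kernel M pol h x.
Proof. by rewrite mulr_ge0 ?fdist_ge0. Qed.

Lemma sum_step_kernel_abs (f g : O -> R) pol h :
  \sum_(x : O * A) `|f x.1 * pol h x.1 x.2 - g x.1 * pol h x.1 x.2| =
  \sum_o `|f o - g o|.
Proof.
rewrite -(pair_bigA _ (fun o a => `|f o * pol h o a - g o * pol h o a|)) /=.
apply: eq_bigr => o _.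
under eq_bigr do rewrite -mulrBl normrM (ger0_norm (fdist_ge0 _ _)).
by rewrite -mulr_sumr fdist_sum1 mulr1.
Qed.

Lemma sum_step_kernel M pol h : \sum_x step_kernel M pol h x = 1.
Proof.
rewrite -(pair_bigA _ (fun o a => next_obs M h o * pol h o a)) /=.
rewrite -(fdist_sum1 (next_obs M h)); apply: eq_bigr => o _.
by rewrite -mulr_sumr fdist_sum1 mulr1.
Qed.

(** Trajectories are grouped by their pair at step [m]. *)
Lemma sum_occupancy M pol m (f : O -> A -> R) :
  \sum_eta traj_prob M pol eta * f (tnth eta m).1 (tnth eta m).2 =
  \sum_o \sum_a occupancy M pol m o a * f o a.
Proof.
rewrite pair_bigA /= (partition_big (fun eta => tnth eta m) xpredT) //=.
apply: eq_bigr => -[y a] _; rewrite /occupancy mulr_suml.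
by apply: eq_bigr => eta /eqP ->.
Qed.

End Kernel.

Lemma sum_dist_traj_prob (R : realType) (O A : finType) (H : nat)
    (M Mhat : nmrdp R O A H) (pol : policy R O A) :
  nm_init Mhat = nm_init M ->
  \sum_eta `|traj_prob Mhat pol eta - traj_prob M pol eta| <=
  \sum_(m < H) \sum_o \sum_a occupancy M pol m o a *
    \sum_o' `|nm_trans Mhat o a o' - nm_trans M o a o'|.
Proof.
move=> same_init.
apply: le_trans (sum_dist_traj_weight [::] H
  (step_kernel_ge0 M pol) (step_kernel_ge0 Mhat pol)
  (sum_step_kernel M pol) (sum_step_kernel Mhat pol)) _.
under eq_bigr => m _.
  under eq_bigr do rewrite /= sum_step_kernel_abs.
  over.
(* Occupancy sums are turned back into averages over trajectories, so that both sides can be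
   compared trajectory by trajectory. *)
under [leRHS]eq_bigr do rewrite
  -(sum_occupancy _ _ _
      (fun o a => \sum_o' `|nm_trans Mhat o a o' - nm_trans M o a o'|)).
case: H M Mhat same_init => [|n] M Mhat same_init; first by rewrite !big_ord0.
(* The indices are off by one: the law at step [m + 1] on the left is governed by the pair at step
   [m] on the right. The first term on the left is thus paired with the last on the right. *)
rewrite big_ord_recl [leRHS]big_ord_recr /= [leLHS]addrC; apply: lerD.
  apply: ler_sum => m _; apply: ler_sum => eta _.
  have -> : take (bump 0 m) eta =
      rcons (take m eta) (tnth eta (widen_ord (leqnSn n) m)).
    rewrite (tnth_nth (thead eta)) /= -take_nth //.
    by rewrite size_tuple ltnS ltnW.
  have next_rcons (N : nmrdp R O A n.+1) s (x : O * A) :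
      next_obs N (rcons s x) = nm_trans N x.1 x.2.
    by case: s => [|y s] //=; rewrite last_rcons.
  by rewrite !next_rcons.
(* The first left term compares the initial laws, which agree, so it vanishes; the last right term
   is nonnegative. *)
rewrite [leLHS]big1 => [|eta _]; last first.
  by rewrite /= take0 /= same_init big1 ?mulr0 // => o _; rewrite subrr normr0.
apply: sumr_ge0 => eta _; rewrite mulr_ge0 ?sumr_ge0 //.
by rewrite traj_probE traj_weight_ge0 //; exact: step_kernel_ge0.
Qed.

Unset Implicit Arguments.
Set Strict Implicit.

Theorem lemma2 (R : realType) (O A : finType) (H : nat) (H_ge1 : (1 <= H)%N)
    (M Mhat : nmrdp R O A H)
    (same_init : nm_init Mhat = nm_init M)
    (same_reward : nm_reward Mhat = nm_reward M)
    (pol : policy R O A) :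
  let epsilon (o' o : O) (a : A) : R :=
    `|nm_trans Mhat o a o' - nm_trans M o a o'| in
  `|exp_return Mhat pol - exp_return M pol| <=
  \sum_(m < H) \sum_(o : O) \sum_(a : A) \sum_(o' : O)
    epsilon o' o a * occupancy M pol m o a * max_return M.
Proof.
cbv zeta.
have same_return eta : traj_return Mhat eta = traj_return M eta.
  by apply: eq_bigr => i _; rewrite /mean_reward same_reward.
rewrite /exp_return -sumrB; apply: le_trans (ler_norm_sum _ _ _) _.
(* Both processes assign the same return to [eta], so it factors out of the difference; being
   nonnegative, it is its own absolute value. *)
apply: (@le_trans _ _ (\sum_eta
    `|traj_prob Mhat pol eta - traj_prob M pol eta| * max_return M)).
  apply: ler_sum => eta _; rewrite same_return -mulrBl normrM.
  rewrite (ger0_norm (traj_return_ge0 _ _)).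
  by rewrite ler_wpM2l // traj_return_le_max.
rewrite -mulr_suml.
apply: le_trans (ler_wpM2r (max_return_ge0 _)
  (sum_dist_traj_prob _ same_init)) _.
(* It remains to distribute the occupancy and [max_return M] into the innermost sum, where the two
   sides are equal. *)
rewrite mulr_suml; apply: ler_sum => m _.
rewrite mulr_suml; apply: ler_sum => o _.
rewrite mulr_suml; apply: ler_sum => a _.
rewrite mulr_sumr mulr_suml; apply: ler_sum => o' _.
by rewrite [X in X * _]mulrC.
Qed.
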